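(* Let $(S,\mathfrak n,k)$ be a local ring and $I\subseteq J$ ideals of $S$. Assume that $S/I$ and $S/J$ are Gorenstein and that $(I:_SJ)\not\subseteq (IJ):_S((J:_S\mathfrak n)J)$. Then there exist elements $a,b\in S$ such that $J=I+(a)$, $(I:_SJ)=I+(b)$, and $(\overline a,\overline b)$ is an exact pair of zerodivisors of $S/I$, where $\overline a,\overline b$ denote the images of $a,b$ in $S/I$.
   Context: All rings are commutative and noetherian. A pair $(x,y)$ of elements of a ring $R$ is an exact pair of zerodivisors if $(0:_Rx)=yR$ and $(0:_Ry)=xR$. *)

(* Defs.v *)
From HB Require Import structures.
From mathcomp Require Import all_boot all_algebra.
From mathcomp Require Import classical_sets.

Set Implicit Arguments.
Unset Strict Implicit.
Unset Printing Implicit Defensive.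

Import GRing.Theory.
Local Open Scope ring_scope.
Local Open Scope classical_set_scope.
Local Open Scope quotient_scope.

(* Given ideals are proper and are MathComp's [idealr] (boolean membership is no
   restriction, classically), so that [{ideal_quot I}] is the quotient ring.
   Ideals built from them, such as I : J, may be the unit ideal, and are
   handled as subsets of the ring. *)
Definition set_of_idealr (R : comNzRingType) (I : idealr R) : set R :=
  [set x | x \in I].
Coercion set_of_idealr : Idealr.type >-> set.

Section Ideals.
Variable R : comNzRingType.
Implicit Types (A B : set R) (x y : R).

Definition ideal_gen (n : nat) (g : 'I_n -> R) : set R :=
  [set x | exists c : 'I_n -> R, x = \sum_(i < n) c i * g i].

Definition principal x : set R := [set y | exists r : R, y = r * x].

Definition ideal_add A B : set R :=
  [set x | exists y z, [/\ A y, B z & x = y + z]].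

Definition ideal_mul A B : set R :=
  [set x | exists (n : nat) (a b : 'I_n -> R),
    [/\ forall i, A (a i), forall i, B (b i) & x = \sum_(i < n) a i * b i]].

Definition colon A B : set R := [set x | forall y, B y -> A (x * y)].

Definition ann x : set R := [set y | y * x = 0].

Definition exact_pair_zerodivisors x y : Prop :=
  ann x = principal y /\ ann y = principal x.

Definition maximal_ideal (m : idealr R) : Prop :=
  forall K : idealr R, m `<=` K -> K = m :> set R.

Definition local_with (m : idealr R) : Prop :=
  maximal_ideal m /\
  forall m' : idealr R, maximal_ideal m' -> m' = m :> set R.

Definition noetherian : Prop :=
  forall K : idealr R, exists (n : nat) (g : 'I_n -> R), K = ideal_gen g :> set R.

(* A local ring is noetherian by convention. *)
Definition local_ring (m : idealr R) : Prop := noetherian /\ local_with m.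

End Ideals.

Section Injective.
Variable R : comNzRingType.

Definition injective_module (E : lmodType R) : Prop :=
  forall (A B : lmodType R) (f : {linear A -> B}) (g : {linear A -> E}),
    injective f -> exists h : {linear B -> E}, forall x, h (f x) = g x.

(* There is an exact sequence 0 -> M -> E 0 -> E 1 -> ... of R-modules with every
   E i injective and E i = 0 for all i > n. *)
Definition injdim_le (M : lmodType R) (n : nat) : Prop :=
  exists (E : nat -> lmodType R) (e : {linear M -> E 0%N})
         (d : forall i, {linear E i -> E i.+1}),
    [/\ forall i, injective_module (E i),
        injective e,
        forall x, d 0%N x = 0 <-> exists y, e y = x,
        forall i x, d i.+1 x = 0 <-> exists y, d i y = x
      & forall i, (n < i)%N -> forall x : E i, x = 0].

Definition finite_injdim (M : lmodType R) : Prop := exists n, injdim_le M n.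

End Injective.

(* A Gorenstein local ring: [R^o] is R as a module over itself. *)
Definition gorenstein (R : comNzRingType) : Prop :=
  (exists m : idealr R, local_ring m) /\ finite_injdim R^o.

(* Main.v *)
(* The failure of the inclusion gives b in I : J, s in J : n and x in J with
   bsx not in IJ.  Then s spans a nonzero socle element of S/J and sb one of S/I,
   and a := x works.  For both quotients R, with socle element sigma <> 0, the key
   fact is: if y is not in xR, then cx = 0 and cy = sigma for some c in R.  If some
   y in J were not in I + (x), this would give c with cx in I and cy - sb in I,
   whence bsx in IJ; the other equalities follow similarly.

   For the key fact, R is injective over itself because it has depth 0 and finite
   injective dimension.  Take an injective resolution E.  Then Ext^n(R/a, R) is the
   cohomology of the annihilators of a in E, and it vanishes for large n.  If
   Ext^(n+1)(-, R) = 0 on cyclic modules with n > 0, so does Ext^n(-, R): for an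
   ideal a maximal among the counterexamples and a nonunit x outside a, either
   a : x <> a, and 0 -> R/(a : x) -> R/a -> R/(a + x) -> 0 applies, or x acts
   surjectively on the finitely generated module Ext^n(R/a, R), and Nakayama's
   lemma applies.  If there is no such x, a is the maximal ideal, R/a embeds in R
   through sigma, and Ext^n(R, R) -> Ext^n(R/a, R) is onto. *)
Require Import Defs.
From HB Require Import structures.
From mathcomp Require Import all_boot all_algebra.
From mathcomp Require Import boolp classical_sets.

Set Implicit Arguments.
Unset Strict Implicit.
Unset Printing Implicit Defensive.

Import GRing.Theory.
Local Open Scope ring_scope.
Local Open Scope classical_set_scope.
Local Open Scope quotient_scope.

(** * Extending linear maps into an injective module *)

Section LinearImage.
Variables (R : comNzRingType) (A B : lmodType R) (f : {linear A -> B}).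

Definition in_linear_image : {pred B} := fun y => `[< exists x, f x = y >].

Lemma in_linear_image_submod_closed : submod_closed in_linear_image.
Proof.
split=> [|a _ _ /asboolP[x <-] /asboolP[y <-]]; apply/asboolP.
  by exists 0; rewrite linear0.
by exists (a *: x + y); rewrite linearP.
Qed.

HB.instance Definition _ := GRing.isSubmodClosed.Build _ _ in_linear_image
  in_linear_image_submod_closed.

(** The image of [f] as a module of its own, since [injective_module] extends maps along injections
    of modules. *)
Record linear_image :=
  LinearImage { linear_image_val : B; _ : linear_image_val \in in_linear_image }.

HB.instance Definition _ := [isSub for linear_image_val].
HB.instance Definition _ := [Choice of linear_image by <:].
HB.instance Definition _ := [SubChoice_isSubLmodule of linear_image by <:].

(** As [g] is constant on the fibres of [f], it descends to the image of [f], and injectivity of [E]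
    extends it from there to [B]. *)
Lemma injective_module_factor (E : lmodType R) (g : {linear A -> E}) :
  injective_module E -> (forall x, f x = 0 -> g x = 0) ->
  exists h : {linear B -> E}, forall x, h (f x) = g x.
Proof.
move=> injE ker_fg.
have preP (y : linear_image) : {x | f x = val y}.
  by apply: cid; apply/asboolP; exact: valP y.
have gE x1 x2 : f x1 = f x2 -> g x1 = g x2.
  move=> e; apply/eqP; rewrite -subr_eq0 -linearB; apply/eqP/ker_fg.
  by rewrite linearB e subrr.
pose g0 (y : linear_image) := g (sval (preP y)).
have g0_lin : linear g0.
  move=> a u v; rewrite /g0 -linearP; apply: gE.
  by rewrite linearP !(svalP (preP _)).
pose g1 : {linear linear_image -> E} :=
  HB.pack g0 (GRing.isSemilinear.Build _ _ _ _ _ (GRing.semilinear_linear g0_lin)).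
have [h hE] := injE linear_image B (val : {linear linear_image -> B}) g1 val_inj.
exists h => x.
have fx : f x \in in_linear_image by apply/asboolP; exists x.
by rewrite -[f x]/(val (LinearImage fx)) hE; apply: gE; rewrite (svalP (preP _)).
Qed.
End LinearImage.

(** * Matrices acting on tuples: [A] as the induced map from [Hom(R^k, E)] to [Hom(R^l, E)] *)

Definition mx_act (R : comNzRingType) (E : lmodType R) l k
  (A : 'M[R]_(l, k)) (f : 'I_k -> E) : 'I_l -> E :=
  fun i => \sum_j A i j *: f j.

Section MatrixAction.
Variables (R : comNzRingType) (E : lmodType R).

Lemma mx_act_mul p l k (B : 'M[R]_(p, l)) (A : 'M_(l, k)) (f : 'I_k -> E) :
  mx_act (B *m A) f =1 mx_act B (mx_act A f).
Proof.
move=> i; rewrite /mx_act; under eq_bigr do rewrite mxE scaler_suml.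
rewrite exchange_big; apply: eq_bigr => j _.
by rewrite scaler_sumr; apply: eq_bigr => a _; rewrite scalerA.
Qed.

Lemma eq_mx_act l k (A : 'M[R]_(l, k)) (f g : 'I_k -> E) :
  f =1 g -> mx_act A f =1 mx_act A g.
Proof. by move=> fg i; apply: eq_bigr => j _; rewrite fg. Qed.

Lemma mx_actD l k (A : 'M[R]_(l, k)) (f g : 'I_k -> E) i :
  mx_act A (fun j => f j + g j) i = mx_act A f i + mx_act A g i.
Proof. by rewrite -big_split; apply: eq_bigr => j _; rewrite scalerDr. Qed.

Lemma mx_actN l k (A : 'M[R]_(l, k)) (f : 'I_k -> E) i :
  mx_act A (fun j => - f j) i = - mx_act A f i.
Proof. by rewrite -sumrN; apply: eq_bigr => j _; rewrite scalerN. Qed.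

Lemma mx_act_sum l k (A : 'M[R]_(l, k)) t (r : 'I_t -> R)
    (f : 'I_t -> 'I_k -> E) i :
  mx_act A (fun j => \sum_s r s *: f s j) i = \sum_s r s *: mx_act A (f s) i.
Proof.
rewrite /mx_act; under eq_bigr do rewrite scaler_sumr.
rewrite exchange_big; apply: eq_bigr => s _; rewrite scaler_sumr.
by apply: eq_bigr => j _; rewrite !scalerA mulrC.
Qed.

Lemma mx_act_linear (F : lmodType R) (d : {linear E -> F}) l k
    (A : 'M[R]_(l, k)) (f : 'I_k -> E) i :
  mx_act A (d \o f) i = d (mx_act A f i).
Proof. by rewrite linear_sum; apply: eq_bigr => j _; rewrite linearZ. Qed.

(** Seen as a map [R^l -> E], [f] vanishes on the kernel of [v |-> v *m A], hence factors through
    [R^k]; the values on the standard basis solve the system. *)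
Lemma injective_module_mx l k (A : 'M[R]_(l, k)) (f : 'I_l -> E) :
  injective_module E ->
  (forall v : 'rV_l, v *m A = 0 -> \sum_i v 0 i *: f i = 0) ->
  exists g : 'I_k -> E, mx_act A g =1 f.
Proof.
move=> injE kerAf.
pose p0 (v : 'rV[R]_l) := \sum_i v 0 i *: f i.
have p0_lin : linear p0.
  move=> a u v; rewrite /p0 scaler_sumr -big_split; apply: eq_bigr => i _.
  by rewrite !mxE scalerDl scalerA.
pose p : {linear 'rV[R]_l -> E} :=
  HB.pack p0
    (GRing.isSemilinear.Build _ _ _ _ _ (GRing.semilinear_linear p0_lin)).
pose mulA : {linear 'rV[R]_l -> 'rV[R]_k} := mulmxr A.
have [h hE] := @injective_module_factor _ _ _ mulA _ p injE kerAf.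
exists (fun j => h (delta_mx 0 j)) => i.
have := hE (delta_mx 0 i); rewrite /= -rowE [row i A]row_sum_delta linear_sum /p0.
rewrite (bigD1 i) //= [X in _ + X]big1 => [|j /negPf ji]; last first.
  by rewrite mxE eqxx ji scale0r.
rewrite mxE !eqxx scale1r addr0 => <-.
by apply: eq_bigr => j _; rewrite linearZ /= mxE.
Qed.
End MatrixAction.

(** * Noetherian and local rings *)

Section Noetherian.
Variable R : comNzRingType.
Implicit Types (a b : set R) (x y r : R).

(** Unlike [idealr], this admits the unit ideal, which may arise as a colon or a sum. *)
Definition ideal_set a := a 0 /\ forall r x y, a x -> a y -> a (r * x + y).

Lemma ideal_setD a x y : ideal_set a -> a x -> a y -> a (x + y).
Proof. by case=> _ h ax ay; rewrite -[x]mul1r; apply: h. Qed.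

Lemma ideal_setM a r x : ideal_set a -> a x -> a (r * x).
Proof. by case=> a0 h ax; rewrite -[_ * _]addr0; apply: h. Qed.

Lemma ideal_set_proper a :
  ideal_set a -> ~ a 1 -> exists K : idealr R, K = a :> set R.
Proof.
move=> [a0 aD] a1.
have cl : idealr_closed (fun x => `[< a x >]).
  split; [exact/asboolP|exact/asboolP|].
  by move=> r x y /asboolP ax /asboolP ay; apply/asboolP; apply: aD.
pose K : idealr R := HB.pack (fun x => `[< a x >]) (isIdealr.Build R _ cl).
exists K; apply/seteqP; split=> x; first by move/asboolP.
by move=> ax; apply/asboolP.
Qed.

Lemma ideal_set_idealr (K : idealr R) : ideal_set K.
Proof.
split=> [|r x y Kx Ky]; first exact: rpred0.
by apply: rpredD => //; exact: idealMr.
Qed.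

Hypothesis noethR : noetherian R.

Lemma noetherian_ideal_set a : ideal_set a ->
  exists l (g : 'I_l -> R), a = ideal_gen g.
Proof.
move=> ia; have [a1|na1] := pselect (a 1).
  exists 1%N, (fun=> 1); apply/seteqP; split=> x ax.
    by exists (fun=> x); rewrite big_ord1 mulr1.
  by rewrite -[x]mulr1; apply: ideal_setM.
by have [K <-] := ideal_set_proper ia na1; exact: noethR.
Qed.

(** Induction on [k]: the first coordinates of [P] form an ideal. Lifts of its generators, together
    with generators of the vectors of [P] with first coordinate [0], generate [P]. *)
Lemma noetherian_rows k (P : set 'rV[R]_k) :
  P 0 -> (forall r u v, P u -> P v -> P (r *: u + v)) ->
  exists l (A : 'M[R]_(l, k)), forall v, P v <-> exists u, v = u *m A.
Proof.
elim: k P => [|k IH] P P0 PD.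
  exists 0%N, 0 => v; split=> [_|_]; first by exists 0; rewrite [v]thinmx0 [RHS]thinmx0.
  by rewrite [v]thinmx0.
change (set 'rV[R]_(1 + k)) in P.
have Pmul l (u : 'rV_l) (A : 'M[R]_(l, 1 + k)) : (forall i, P (row i A)) -> P (u *m A).
  move=> PA; rewrite mulmx_sum_row; apply: big_ind => // [x y Px Py|i _].
    by rewrite -[x]scale1r; apply: PD.
  by rewrite -[_ *: _]addr0; apply: PD.
pose a x := exists2 v, P v & lsubmx v = x%:M.
have [|t [g ag]] := @noetherian_ideal_set a.
  split=> [|r x y [u Pu ux] [v Pv vy]].
    by exists 0 => //; rewrite linear0 raddf0.
  exists (r *: u + v); first exact: PD.
  by rewrite linearP /= ux vy scale_scalar_mx raddfD.
have /choice[w wP] i : exists v : 'rV[R]_(1 + k), P v /\ lsubmx v = (g i)%:M.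
  suff [v ? ?] : a (g i) by exists v.
  rewrite ag; exists (fun j => (j == i)%:R).
  rewrite (bigD1 i) //= eqxx mul1r big1 ?addr0 // => j /negPf ->.
  by rewrite mul0r.
have [||l [A AP]] := IH (fun v => P (row_mx 0 v)).
- by rewrite row_mx0.
- move=> r u v Pu Pv; have -> : 0 = r *: 0 + 0 :> 'M[R]_1 by rewrite scaler0 addr0.
  by rewrite -add_row_mx -scale_row_mx; apply: PD.
pose W : 'M[R]_(t, 1 + k) := \matrix_i w i.
have PW u : P (u *m W) by apply: Pmul => i; rewrite rowK; case: (wP i).
have PB u : P (u *m row_mx 0 A).
  by rewrite mul_mx_row mulmx0; apply/AP; exists u.
exists (t + l)%N, (col_mx W (row_mx 0 A)).
suff genP (v : 'rV[R]_(1 + k)) : P v -> exists u, v = u *m col_mx W (row_mx 0 A).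
  move=> v; split=> [/genP //|[u ->]].
  by rewrite -[u]hsubmxK mul_row_col -[_ *m W]scale1r; apply: PD.
move=> Pv.
have [c cE] : ideal_gen g (v 0 0).
  rewrite -ag; exists v => //; apply/rowP => i; rewrite !ord1 !mxE eqxx mulr1n.
  by congr (v 0 _); apply: val_inj.
pose cv := \row_i c i.
have lW : lsubmx (cv *m W) = lsubmx v.
  apply/rowP => i; rewrite !ord1 {i} !mxE.
  rewrite (_ : lshift k 0 = 0) ?cE; last exact: val_inj.
  apply: eq_bigr => i _; rewrite !mxE; congr (_ * _).
  have [_ /rowP/(_ 0)] := wP i; rewrite !mxE eqxx mulr1n => <-.
  by congr (w i 0 _); apply: val_inj.
have : P (v - cv *m W) by rewrite addrC -scaleN1r; apply: PD.
rewrite -[_ - _]hsubmxK linearB /= lW subrr => /AP[u uE].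
exists (row_mx cv u); rewrite mul_row_col mul_mx_row mulmx0 -uE.
apply/eqP; rewrite addrC -subr_eq -{1}[v - _]hsubmxK linearB /= lW subrr; exact/eqP.
Qed.

(** A counterexample would start a strictly increasing chain of ideals, but the union is finitely
    generated and so equals some [c N]. *)
Lemma noetherian_ind (P : set R -> Prop) :
  (forall a, ideal_set a ->
     (forall b, ideal_set b -> a `<=` b -> b <> a -> P b) -> P a) ->
  forall a, ideal_set a -> P a.
Proof.
move=> step a0 ia0; apply: contrapT => nPa0.
pose T := {a | ideal_set a /\ ~ P a}.
have /choice[f fP] (t : T) :
    exists t' : T, sval t `<=` sval t' /\ sval t' <> sval t.
  case: t => a [ia nPa]; apply: contrapT => H.
  apply: (nPa); apply: step => // b ib ab ba.
  apply: contrapT => nPb; apply: H.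
  by exists (exist _ b (conj ib nPb)); split; [exact: ab|exact: ba].
pose c i : set R := sval (iter i f (exist _ a0 (conj ia0 nPa0) : T)).
have ic i : ideal_set (c i) by rewrite /c; case: (iter _ _ _) => a [].
have c_mono i j : (i <= j)%N -> c i `<=` c j.
  elim: j => [|j IH]; first by rewrite leqn0 => /eqP->.
  rewrite leq_eqVlt => /predU1P[->//|/IH ij]; apply: subset_trans ij _.
  exact: (fP (iter j f (exist _ a0 (conj ia0 nPa0)))).1.
pose u x := exists i, c i x.
have iu : ideal_set u.
  split=> [|r x y [i ci] [j cj]]; first by exists 0%N; case: (ic 0%N).
  exists (maxn i j); case: (ic (maxn i j)) => _; apply.
    exact: (c_mono _ _ (leq_maxl i j)).
  exact: (c_mono _ _ (leq_maxr i j)).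
have [l [g ug]] := noetherian_ideal_set iu.
have /choice[e eP] i : exists j, c j (g i).
  change (u (g i)); rewrite ug; exists (fun j => (j == i)%:R).
  rewrite (bigD1 i) //= eqxx mul1r big1 ?addr0 // => j /negPf ->.
  by rewrite mul0r.
pose N := \max_i e i.
have uN x : u x -> c N x.
  rewrite ug => -[r ->]; apply: big_ind => [|y z|i _]; first by case: (ic N).
    exact: ideal_setD.
  by apply: ideal_setM => //; apply: c_mono (eP i); exact: leq_bigmax.
have [_] := fP (iter N f (exist _ a0 (conj ia0 nPa0))); apply.
apply/seteqP; split=> x; last exact: (c_mono N N.+1 (leqnSn N)).
by move=> cx; apply: uN; exists N.+1.
Qed.

Lemma sub_maximal_ideal (K : idealr R) :
  exists2 m : idealr R, maximal_ideal m & K `<=` m.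
Proof.
have K1 : ~ (K : set R) 1 by rewrite /set_of_idealr /= idealr1.
have : ideal_set K := ideal_set_idealr K.
move=> iK; move: (K : set R) iK K1 => a.
elim/noetherian_ind => {}a ia IH a1.
have [[b [ib ab ba b1]]|max_a] := pselect
    (exists b, [/\ ideal_set b, a `<=` b, b <> a & ~ b 1]).
  by have [m mm bm] := IH b ib ab ba b1; exists m => //; exact: subset_trans bm.
have [m mE] := ideal_set_proper ia a1; exists m; last by rewrite mE.
move=> L; rewrite mE => aL; apply: contrapT => La; apply: max_a.
exists L; split=> //; first exact: ideal_set_idealr.
by rewrite /set_of_idealr /= idealr1.
Qed.
End Noetherian.

(** Otherwise [principal x] is proper and lies in a maximal ideal, which can only be [m]. *)
Lemma local_ring_unit (R : comNzRingType) (m : idealr R) x :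
  local_ring m -> x \notin m -> exists y, y * x = 1.
Proof.
move=> [noethR [max_m uniq_m]] xm.
have ix : ideal_set (principal x).
  split=> [|r _ _ [s ->] [t ->]]; first by exists 0; rewrite mul0r.
  by exists (r * s + t); rewrite mulrDl mulrA.
have [[y xy]|nx1] := pselect (principal x 1); first by exists y.
have [K KE] := ideal_set_proper ix nx1.
have [m' max_m' Km'] := sub_maximal_ideal noethR K.
case/negP: xm; change ((m : set R) x); rewrite -(uniq_m _ max_m'); apply: Km'.
by rewrite KE; exists 1; rewrite mul1r.
Qed.

Lemma nakayama (R : comNzRingType) (V : lmodType R) (Z B : set V) (x : R) :
  (forall r, exists s, s * (1 - r * x) = 1) ->
  B 0 -> (forall r u v, B u -> B v -> B (r *: u + v)) ->
  (forall z, Z z -> exists2 z', Z z' & B (z - x *: z')) ->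
  forall t (e : 'I_t -> V), (forall i, Z (e i)) ->
  (forall z, Z z -> exists r : 'I_t -> R, B (z - \sum_i r i *: e i)) ->
  Z `<=` B.
Proof.
move=> unitx B0 BD ZxZ; elim=> [|t IH] e Ze gen_e.
  by move=> z /gen_e[r]; rewrite big_ord0 subr0.
have [z' Zz' Bz'] := ZxZ _ (Ze ord0).
have [r] := gen_e _ Zz'; have [s] := unitx (r ord0).
rewrite big_ord_recl; set y := \sum_(i < t) _ => sE Br.
have Be0 : B (e ord0 - (s * x) *: y).
  have := BD (s * x) _ _ Br (BD s _ _ Bz' B0); congr B.
  rewrite addr0 !scalerBr scalerDr !scalerA addrC subrKA opprD addrA -scalerBl.
  by rewrite -mulrA -{1}[s]mulr1 -mulrBr [x * _]mulrC sE scale1r.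
apply: (IH (e \o lift ord0)) => [i|z /gen_e[c]]; first exact: Ze.
rewrite big_ord_recl => Bz.
exists (fun i => c ord0 * (s * x) * r (lift ord0 i) + c (lift ord0 i)).
have := BD (c ord0) _ _ Be0 Bz; congr B.
rewrite scalerBr addrC opprD [z + _]addrA [z - _ - _]addrAC subrKA -addrA -opprD.
rewrite scalerA /y scaler_sumr -big_split /=.
by congr (_ - _); apply: eq_bigr => i _; rewrite addrC scalerDl scalerA.
Qed.

(** * Ext of cyclic modules, from an injective resolution of [R] *)

Section Resolution.
Variables (R : comNzRingType) (E : nat -> lmodType R) (e : {linear R^o -> E 0%N}).
Variable d : forall i, {linear E i -> E i.+1}.
Hypothesis noethR : noetherian R.
Hypothesis injE : forall i, injective_module (E i).
Hypothesis inj_e : injective e.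
Hypothesis ker_d0 : forall x, d 0%N x = 0 <-> exists y, e y = x.
Hypothesis ker_dS : forall i x, d i.+1 x = 0 <-> exists y, d i y = x.
Implicit Types (a : set R) (x r : R).

Definition killed (V : lmodType R) a (y : V) := forall r, a r -> r *: y = 0.

Definition cocycle a n (y : E n) := killed a y /\ d n y = 0.

(* [Hom(R/a, E n)] is the annihilator of [a] in [E n], so this says that
   [Ext^(n+1)(R/a, R) = 0]. *)
Definition ext_vanish n a :=
  forall y : E n.+1, cocycle a y -> exists2 z : E n, killed a z & d n z = y.

(** The coboundaries of the complex [Hom(R^k/A, E)], where [R^k/A] is the quotient by the rows of
    [A]. *)
Definition coboundary n : forall k l, 'M[R]_(l, k) -> ('I_k -> E n) -> Prop :=
  match n with
  | 0 => fun k l A y => forall j, y j = 0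
  | m.+1 => fun k l A y => exists2 h : 'I_k -> E m,
      mx_act A h =1 (fun=> 0) & forall j, y j = d m (h j)
  end.

Lemma dd n y : d n.+1 (d n y) = 0.
Proof. by apply/ker_dS; exists y. Qed.

(** In positive degree [f = d g] and [g = A h], so [d h] is a preimage of [f], and it is a
    cocycle. *)
Lemma coboundary_lift n k l p (A : 'M[R]_(l, k)) (A' : 'M[R]_(p, l))
    (f : 'I_l -> E n) :
  (forall m (g : 'I_l -> E m), mx_act A' g =1 (fun=> 0) ->
     exists h : 'I_k -> E m, mx_act A h =1 g) ->
  coboundary A' f ->
  exists2 h : 'I_k -> E n, mx_act A h =1 f & forall j, d n (h j) = 0.
Proof.
case: n f => [|n] f lift /=.
  move=> f0; exists (fun=> 0) => [i|j]; last by rewrite linear0.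
  by rewrite f0 /mx_act big1 // => j _; rewrite scaler0.
move=> [g /lift[h hE] fE]; exists (d n \o h) => [i|j]; last by rewrite /= dd.
by rewrite mx_act_linear hE fE.
Qed.

(* The generators are those of [Ext^n(R^k/A, R)]; they are found by the dimension
   shift [Ext^(n+1)(R^k/A, R) <- Ext^n(R^l/A', R)] with [A'] the syzygies of [A]. *)
Lemma ext_fin_gen n k l (A : 'M[R]_(l, k)) :
  exists t (es : 'I_t -> 'I_k -> E n),
  (forall s, mx_act A (es s) =1 (fun=> 0) /\ forall j, d n (es s j) = 0) /\
  forall y, mx_act A y =1 (fun=> 0) -> (forall j, d n (y j) = 0) ->
  exists r : 'I_t -> R, coboundary A (fun j => y j - \sum_s r s *: es s j).
Proof.
elim: n k l A => [|n IH] k l A.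
  (* Through [e], the cocycles of degree [0] are [Hom(R^k/A, R)]: the columns killed by [A], written
     here as rows. *)
  have [||t [G GP]] := noetherian_rows noethR (P := fun u => u *m A^T = 0).
  - by rewrite mul0mx.
  - by move=> r u v u0 v0; rewrite mulmxDl -scalemxAl u0 v0 scaler0 addr0.
  have eA (c : 'I_k -> R) i :
      mx_act A (fun j => e (c j)) i = e ((\row_j c j *m A^T) 0 i).
    rewrite mxE linear_sum; apply: eq_bigr => j _.
    by rewrite -linearZ !mxE /= [A i j *: _]mulrC.
  exists t, (fun s j => e (G s j)); split=> [s|y Ay dy].
    split=> [i|j]; last by apply/ker_d0; exists (G s j).
    rewrite eA (_ : \row_j _ = row s G); last by apply/rowP => j; rewrite !mxE.
    suff -> : row s G *m A^T = 0 by rewrite mxE linear0.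
    by apply/GP; exists (delta_mx 0 s); rewrite rowE.
  have /choice[c cE] j : exists c, e c = y j by apply/ker_d0.
  have /GP[r rE] : \row_j c j *m A^T = 0.
    apply/rowP => i; apply: inj_e.
    rewrite [RHS](_ : _ = 0); last by rewrite mxE linear0.
    by rewrite -eA -[RHS](Ay i); apply: eq_mx_act.
  exists (r 0) => j /=; rewrite -cE; apply/eqP; rewrite subr_eq0; apply/eqP.
  have := congr1 (fun M : 'rV_k => M 0 j) rE; rewrite mxE => ->.
  by rewrite mxE linear_sum; apply: eq_bigr => s _; rewrite -linearZ.
have [||p [A' A'P]] := noetherian_rows noethR (P := fun v => v *m A = 0).
- by rewrite mul0mx.
- by move=> r u v u0 v0; rewrite mulmxDl -scalemxAl u0 v0 scaler0 addr0.
have A'A : A' *m A = 0.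
  apply/row_matrixP => i; rewrite row_mul row0.
  by apply/A'P; exists (delta_mx 0 i); rewrite rowE.
(* Exactness of [R^p -> R^l -> R^k] is preserved by [Hom(-, E m)]. *)
have lift m (g : 'I_l -> E m) : mx_act A' g =1 (fun=> 0) ->
    exists h : 'I_k -> E m, mx_act A h =1 g.
  move=> A'g; apply: injective_module_mx => // v /A'P[u ->].
  rewrite -[LHS]/(mx_act (u *m A') g 0) mx_act_mul /mx_act big1 // => i _.
  by rewrite -[X in _ *: X]/(mx_act A' g i) A'g scaler0.
have [t [fs [fsP fs_gen]]] := IH _ _ A'.
have /choice[es esE] s : exists h : 'I_k -> E n, mx_act A h =1 fs s.
  by apply: lift; case: (fsP s).
exists t, (fun s => d n \o es s); split=> [s|y Ay dy].
  split=> [i|j]; last by rewrite /= dd.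
  by rewrite mx_act_linear esE; case: (fsP s).
(* With [y = d z], [A z] is a cocycle for [A'] one degree lower, to which [fs_gen] applies. *)
have /choice[z zE] j : exists z, d n z = y j by apply/ker_dS.
have [||r /(coboundary_lift lift)[h hE dh]] := fs_gen (mx_act A z).
- move=> i; rewrite -mx_act_mul A'A /mx_act big1 // => j _.
  by rewrite mxE scale0r.
- by move=> i; rewrite -mx_act_linear -[RHS](Ay i); apply: eq_mx_act => j /=.
exists r; exists (fun j => z j - \sum_s r s *: es s j - h j).
  move=> i; rewrite mx_actD mx_actN mx_actD mx_actN mx_act_sum hE.
  by under eq_bigr do rewrite esE; rewrite subrr.
move=> j; rewrite !linearB dh subr0 zE (linear_sum (d n)); congr (_ - _).
by apply: eq_bigr => s _; rewrite linearZ.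
Qed.

(** Multiplication by [x] embeds [R/(a : x)] in [R/a], so [Hom(R/a, E n) -> Hom(R/(a : x), E n)] is
    onto. *)
Lemma killed_div a x n (z : E n) : ideal_set a ->
  (forall r, a (r * x) -> r *: z = 0) ->
  exists2 z', killed a z' & x *: z' = z.
Proof.
move=> ia z0; have [l [g ag]] := noetherian_ideal_set noethR ia.
(* The system reads [g i *: z' = 0] for the generators of [a], and [x *: z' = z]. *)
pose A : 'M[R]_(l + 1, 1) := col_mx (\col_i g i) x%:M.
pose f (i : 'I_(l + 1)) := if split i is inl _ then 0 else z.
have fl i : f (lshift 1 i) = 0 by rewrite /f (unsplitK (inl i)).
have fr i : f (rshift l i) = z by rewrite /f (unsplitK (inr i)).
have [|z' z'E] := injective_module_mx (A := A) (f := f) (@injE n).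
  move=> v /rowP/(_ 0); rewrite mxE [X in _ = X]mxE !big_split_ord /= !big_ord1.
  rewrite !col_mxEd mxE eqxx mulr1n => vE.
  rewrite big1 ?add0r => [|i _]; last by rewrite fl scaler0.
  rewrite fr; apply: z0; rewrite ag; exists (fun i => - v 0 (lshift 1 i)).
  move/eqP: vE; rewrite addrC addr_eq0 => /eqP ->; rewrite -sumrN.
  by apply: eq_bigr => i _; rewrite col_mxEu mxE mulNr.
exists (z' 0).
  move=> r; rewrite ag => -[c ->]; rewrite scaler_suml big1 // => i _.
  have := z'E (lshift 1 i); rewrite fl /mx_act big_ord1 col_mxEu mxE => gz.
  by rewrite -scalerA gz scaler0.
by have := z'E (rshift l 0); rewrite fr /mx_act big_ord1 col_mxEd mxE eqxx mulr1n.
Qed.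

Definition ideal_adjoin a x : set R :=
  [set u | exists s r, a s /\ u = s + r * x].

Lemma ideal_adjoin_sub a x : a `<=` ideal_adjoin a x.
Proof. by move=> s as_; exists s, 0; rewrite mul0r addr0. Qed.

Lemma ideal_adjoin_in a x : ideal_set a -> ideal_adjoin a x x.
Proof. by move=> [a0 _]; exists 0, 1; rewrite add0r mul1r. Qed.

Lemma ideal_set_adjoin a x : ideal_set a -> ideal_set (ideal_adjoin a x).
Proof.
move=> ia; split=> [|r _ _ [s [t [as_ ->]]] [s' [t' [as' ->]]]].
  by apply: ideal_adjoin_sub; case: ia.
exists (r * s + s'), (r * t + t'); split; first by case: ia => _; apply.
by rewrite mulrDr mulrDl addrACA mulrA.
Qed.

Lemma ideal_set_colon a x : ideal_set a -> ideal_set (fun r => a (r * x)).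
Proof.
move=> [a0 aD]; split=> [|r s t as_ at_]; first by rewrite mul0r.
by rewrite mulrDl -mulrA; apply: aD.
Qed.

Lemma killed_adjoin (V : lmodType R) a x (z : V) : ideal_set a ->
  killed (ideal_adjoin a x) z <-> killed a z /\ x *: z = 0.
Proof.
move=> ia; split=> [kz|[kz xz] _ [s [t [as_ ->]]]].
  by split=> [r ar|]; apply: kz; [exact: ideal_adjoin_sub|exact: ideal_adjoin_in].
by rewrite scalerDl -scalerA kz // xz scaler0 addr0.
Qed.

Lemma killedB (V : lmodType R) a (y z : V) :
  killed a y -> killed a z -> killed a (y - z).
Proof. by move=> ky kz r ar; rewrite scalerBr ky ?kz ?subr0. Qed.

Lemma killedZ (V : lmodType R) a r (y : V) : killed a y -> killed a (r *: y).
Proof. by move=> ky s as_; rewrite scalerA mulrC -scalerA ky ?scaler0. Qed.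

(** The connecting map lands in the Ext of [R/(a + x)] that vanishes: for a lift [z] of [y], [d z]
    is a cocycle for [a + x], and subtracting [z'] turns [z] into a cocycle. *)
Lemma cocycle_div a x n (y : E n) : ideal_set a ->
  ext_vanish n (ideal_adjoin a x) ->
  cocycle (fun r => a (r * x)) y -> exists2 y', cocycle a y' & x *: y' = y.
Proof.
move=> ia van [ky dy]; have [z kz xz] := killed_div ia ky.
have [|z' /(killed_adjoin _ _ ia)[kz' xz'] dz'] := van (d n z).
  split; last exact: dd.
  apply/killed_adjoin => //; split=> [r ar|]; last by rewrite -linearZ xz.
  by rewrite -linearZ /= kz // linear0.
exists (z - z'); last by rewrite scalerBr xz xz' subr0.
by split; [exact: killedB|rewrite linearB dz' subrr].
Qed.

(** Exactness of the long Ext sequence at the middle term [R/a]. *)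
Lemma ext_vanish_colon a x n : ideal_set a ->
  ext_vanish n (fun r => a (r * x)) -> ext_vanish n (ideal_adjoin a x) ->
  ext_vanish n a.
Proof.
move=> ia vanC vanA y [ky dy].
have [|z kz dz] := vanC (x *: y).
  split; last by rewrite linearZ /= dy scaler0.
  by move=> r arx; rewrite scalerA ky.
have [w kw xw] := killed_div ia kz.
have [|z' /(killed_adjoin _ _ ia)[kz' xz'] dz'] := vanA (y - d n w).
  split; last by rewrite linearB dy dd subrr.
  apply/killed_adjoin => //; split.
    by apply: killedB => // r ar; rewrite -linearZ /= kw // linear0.
  by rewrite scalerBr -linearZ xw dz subrr.
exists (z' + w); last by rewrite linearD dz' subrK.
by move=> r ar; rewrite scalerDr kz' ?kw ?addr0.
Qed.

(** * Descent of the vanishing of Ext to lower degrees *)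

Variable sigma : R.
Let nonunit x := ~ exists y, y * x = 1.
Hypothesis sigma0 : sigma <> 0.
Hypothesis socle_sigma : forall r, nonunit r -> r * sigma = 0.
Hypothesis loc : forall x r, nonunit x -> exists s, s * (1 - r * x) = 1.

(** Here [a] is the annihilator of [sigma], so [y = sigma y'] for a cocycle [y'] of the resolution
    itself. Exactness gives [y' = d z], and [sigma z] is killed by [a]. *)
Lemma ext_vanish_max a n : ideal_set a -> ~ a 1 -> nonunit `<=` a ->
  ext_vanish n.+1 (ideal_adjoin [set 0] sigma) -> ext_vanish n a.
Proof.
move=> ia a1 maxa van y [ky dy].
have a_nu r : a r -> nonunit r.
  by move=> ar [s sr]; apply: a1; rewrite -sr; apply: ideal_setM.
have i0 : ideal_set [set 0 : R].
  by split=> // r x x' -> ->; rewrite mulr0 addr0.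
have [|y' [_ /ker_dS[z dz]] yE] := cocycle_div i0 van (y := y).
  split=> // r /= rs; apply: ky; apply: maxa => -[s sr]; apply: sigma0.
  by rewrite -[sigma]mul1r -sr -mulrA rs mulr0.
exists (sigma *: z); last by rewrite linearZ dz.
by move=> r /a_nu/socle_sigma rs; rewrite scalerA rs scale0r.
Qed.

(** As [(a : x) = a], [cocycle_div] makes [x] surjective on cocycles, and Nakayama's lemma applies
    modulo coboundaries. *)
Lemma ext_vanish_nzd a x n : ideal_set a -> nonunit x ->
  (forall r, a (r * x) -> a r) ->
  ext_vanish n.+1 (ideal_adjoin a x) -> ext_vanish n a.
Proof.
move=> ia nux xreg van y cy; have [l [g ag]] := noetherian_ideal_set noethR ia.
pose A : 'M[R]_(l, 1) := \col_i g i.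
have AP m (f : 'I_1 -> E m) : mx_act A f =1 (fun=> 0) <-> killed a (f 0).
  split=> [Af r|kf i].
    rewrite ag => -[c ->]; rewrite scaler_suml big1 // => i _.
    by have := Af i; rewrite /mx_act big_ord1 mxE -scalerA => ->; rewrite scaler0.
  rewrite /mx_act big_ord1 mxE; apply: kf; rewrite ag.
  exists (fun j => (j == i)%:R); rewrite (bigD1 i) //= eqxx mul1r.
  by rewrite big1 ?addr0 // => j /negPf ->; rewrite mul0r.
have [t [es [esP es_gen]]] := ext_fin_gen n.+1 A.
pose B : set (E n.+1) := [set y | exists2 z, killed a z & d n z = y].
apply: (@nakayama _ _ (@cocycle a n.+1) B x _ _ _ _ t (es^~ 0)) => //.
- by move=> r; apply: loc.
- by exists 0; rewrite ?linear0 // => r ar; rewrite scaler0.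
- move=> r _ _ [u ku <-] [v kv <-]; exists (r *: u + v); last by rewrite linearP.
  by move=> s as_; rewrite scalerDr (killedZ r ku) ?kv ?addr0.
- move=> z [kz dz]; have [|z' cz' xz'] := cocycle_div ia van (y := z).
    by split=> // r /xreg; exact: kz.
  exists z' => //; exists 0; first by move=> r ar; rewrite scaler0.
  by rewrite xz' linear0 subrr.
- by move=> s; have [/AP ks ds] := esP s.
move=> z [kz dz]; have [||r [h /AP kh hE]] := es_gen (fun=> z) => //; first exact/AP.
by exists r; exists (h 0) => //; rewrite -hE.
Qed.

Lemma ext_vanish_step n : (forall a, ideal_set a -> ext_vanish n.+1 a) ->
  forall a, ideal_set a -> ext_vanish n a.
Proof.
move=> van; apply: (noetherian_ind noethR) => a ia IH.
have [a1|a1] := pselect (a 1).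
  move=> y [ky _]; have -> : y = 0 by rewrite -[y]scale1r ky.
  by exists 0; rewrite ?linear0 // => r _; rewrite scaler0.
have [[x nux ax]|maxa] := pselect (exists2 x, nonunit x & ~ a x); last first.
  apply: ext_vanish_max => //.
    by move=> x nux; apply: contrapT => ax; apply: maxa; exists x.
  apply: van; apply: ideal_set_adjoin.
  by split=> // r u v -> ->; rewrite mulr0 addr0.
have iax := ideal_set_adjoin x ia.
(* If [x] is a zerodivisor modulo [a], both [a : x] and [a + x] are strictly larger than [a]. *)
have [[s asx as_]|xreg] := pselect (exists2 s, a (s * x) & ~ a s).
  apply: (ext_vanish_colon (x := x)) => //; apply: IH => //.
  - exact: ideal_set_colon.
  - by move=> r ar; rewrite mulrC; apply: ideal_setM.
  - by move=> ca; apply: as_; rewrite -ca.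
  - exact: ideal_adjoin_sub.
  - by move=> aa; apply: ax; rewrite -aa; apply: ideal_adjoin_in.
apply: ext_vanish_nzd nux _ _ => //; last exact: van.
by move=> r arx; apply: contrapT => ar; apply: xreg; exists r.
Qed.

(** Since [ext_vanish n] concerns [E n.+1], it is trivial once [N <= n]; [k] counts the descents
    from there. *)
Lemma ext_vanish_all N : (forall i, (N < i)%N -> forall x : E i, x = 0) ->
  forall n a, ideal_set a -> ext_vanish n a.
Proof.
move=> E0 n; have [k] : exists k, (N <= n + k)%N by exists N; exact: leq_addl.
elim: k n => [|k IH] n Nn.
  move=> a ia y _; rewrite addn0 in Nn; rewrite (E0 _ _ y) //.
  by exists 0; rewrite ?linear0 // => r _; rewrite scaler0.
by apply: ext_vanish_step; apply: IH; rewrite addSnnS.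
Qed.

(** The equations [x z = 0], [y z = e sigma] are solvable in [E 0], because [r y] in [xR] makes [r]
    a nonunit. The obstruction to a solution in [R] is the class of [d z] in
    [Ext^1(R/(x, y), R) = 0]. *)
Lemma colon_socle N : (forall i, (N < i)%N -> forall x : E i, x = 0) ->
  forall x y, ~ principal x y -> exists2 c, c * x = 0 & c * y = sigma.
Proof.
move=> E0 x y xy.
have ix : ideal_set (principal x).
  split=> [|r _ _ [s ->] [t ->]]; first by exists 0; rewrite mul0r.
  by exists (r * s + t); rewrite mulrDl mulrA.
have [|z kz yz] := killed_div (x := y) (z := e sigma) ix.
  move=> r ry; rewrite -linearZ /= [r *: _]socle_sigma ?linear0 // => -[s sr].
  by apply: xy; rewrite -[y]mul1r -sr -mulrA; apply: ideal_setM.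
have xz : x *: z = 0 by apply: kz; exists 1; rewrite mul1r.
have dyz : d 0%N (y *: z) = 0 by rewrite yz; apply/ker_d0; exists sigma.
have [|w /(killed_adjoin _ _ ix)[kw yw] dw] :=
    ext_vanish_all E0 (n := 0) (ideal_set_adjoin y ix) (y := d 0%N z).
  split; last exact: dd.
  apply/killed_adjoin => //; split; last by rewrite -linearZ.
  by move=> r xr; rewrite -linearZ /= kz // linear0.
have /ker_d0[c cE] : d 0%N (z - w) = 0 by rewrite linearB dw subrr.
have ce r : e (c * r) = r *: (z - w) by rewrite -cE -linearZ /= mulrC.
exists c; apply: inj_e; rewrite ce scalerBr ?yz ?yw ?subr0 //.
by rewrite xz kw ?subr0 ?linear0 //; exists 1; rewrite mul1r.
Qed.
End Resolution.

(** The disjunction puts [sigma] in the socle without naming the maximal ideal, whose existence is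
    part of [gorenstein]. *)
Lemma gorenstein_colon_socle (R : comNzRingType) (sigma : R) :
  gorenstein R -> sigma <> 0 ->
  (forall r, (exists s, s * r = 1) \/ r * sigma = 0) ->
  forall x y, ~ principal x y -> exists2 c, c * x = 0 & c * y = sigma.
Proof.
move=> [[m locm] [N [E [e [d [injE inj_e ker_d0 ker_dS E0]]]]]] sigma0 soc.
have m_nonunit x : ~ (exists s, s * x = 1) -> x \in m.
  by move=> nux; apply: contrapT => /negP xm; apply: nux; apply: local_ring_unit xm.
apply: (colon_socle locm.1 injE inj_e ker_d0 ker_dS sigma0 _ _ E0) => [r|x r nux].
  by case: (soc r).
apply: (local_ring_unit locm); apply/negP => h.
have : 1 - r * x + r * x \in m by rewrite rpredD // idealMr // m_nonunit.
by rewrite subrK idealr1.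
Qed.

(** * Reading the socle property of [S/I] in [S] *)

Section QuotientRing.
Variables (S : comNzRingType) (I : idealr S).
Local Notation pi := (\pi_{ideal_quot I}).

Lemma ideal_quot_pi0 x : pi x = 0 <-> (I : set S) x.
Proof.
rewrite -(rmorph0 pi) /set_of_idealr /= -[x in x \in I]subr0 Quotient.idealrBE.
by split=> /eqP.
Qed.

Lemma principal_pi x y : principal (pi x) (pi y) <-> ideal_add I (principal x) y.
Proof.
split=> [[r]|[i [_ [Ii [r ->] ->]]]].
  rewrite -[r]reprK -rmorphM => /eqP; rewrite -subr_eq0 -rmorphB.
  move=> /eqP/ideal_quot_pi0 yx.
  exists (y - repr r * x), (repr r * x); split=> //; first by exists (repr r).
  by rewrite subrK.
exists (pi r); rewrite rmorphD rmorphM /=.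
by move/ideal_quot_pi0: Ii => ->; rewrite add0r.
Qed.

Lemma gorenstein_quot_colon_socle (n : idealr S) t :
  local_ring n -> gorenstein {ideal_quot I} ->
  ~ (I : set S) t -> (forall r, (n : set S) r -> (I : set S) (r * t)) ->
  forall x y, ~ ideal_add I (principal x) y ->
  exists2 c, (I : set S) (c * x) & (I : set S) (c * y - t).
Proof.
move=> locn gorI It nt x y Ixy.
have [|r||c cx cy] := @gorenstein_colon_socle _ (pi t) gorI _ _ (pi x) (pi y).
- by move/ideal_quot_pi0.
- rewrite -[r]reprK; have [rn|rn] := boolP (repr r \in n).
    by right; rewrite -rmorphM; apply/ideal_quot_pi0/nt.
  have [s sr] := local_ring_unit locn rn.
  by left; exists (pi s); rewrite -rmorphM sr rmorph1.
- by move/principal_pi.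
exists (repr c); apply/ideal_quot_pi0; first by rewrite rmorphM /= reprK.
by rewrite rmorphB rmorphM /= reprK cy subrr.
Qed.
End QuotientRing.

(** * Products of ideals and the construction of the exact pair *)

Lemma ideal_mul_sum (R : comNzRingType) (A B : set R) t (F : 'I_t -> R) :
  (forall i, ideal_mul A B (F i)) -> ideal_mul A B (\sum_i F i).
Proof.
move=> FAB; apply: big_ind => //
  [|_ _ [n [a [b [Aa Bb ->]]]] [m [a' [b' [Aa' Bb' ->]]]]].
  by exists 0%N, (fun=> 0), (fun=> 0); split=> [[]//|[]//|]; rewrite big_ord0.
pose cat T (f : 'I_n -> T) g (i : 'I_(n + m)) :=
  match split i with inl j => f j | inr j => g j end.
exists (n + m)%N, (cat _ a a'), (cat _ b b'); split.
- by move=> i; rewrite /cat; case: (split i).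
- by move=> i; rewrite /cat; case: (split i).
rewrite big_split_ord /=; congr (_ + _); apply: eq_bigr => i _.
  by rewrite /cat (unsplitK (inl i)).
by rewrite /cat (unsplitK (inr i)).
Qed.

Lemma ideal_mul_in (R : comNzRingType) (A B : set R) x y :
  A x -> B y -> ideal_mul A B (x * y).
Proof. by exists 1%N, (fun=> x), (fun=> y); split=> //; rewrite big_ord1. Qed.

Theorem corollary3p6 (S : comNzRingType) (n : idealr S) (hS : local_ring n)
    (I J : idealr S) (hIJ : I `<=` J)
    (hI : gorenstein {ideal_quot I}) (hJ : gorenstein {ideal_quot J})
    (hcolon : ~ (colon I J `<=`
                 colon (ideal_mul I J) (ideal_mul (colon J n) J))) :
  exists a b : S,
    [/\ J = ideal_add I (principal a) :> set S,
        colon I J = ideal_add I (principal b)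
      & exact_pair_zerodivisors
          (\pi_{ideal_quot I} a) (\pi_{ideal_quot I} b)].
Proof.
have iI := ideal_set_idealr I; have iJ := ideal_set_idealr J.
(* An element of [(J : n) J] is a sum of products [s x], so one product already violates the
   inclusion. *)
have [b [s [x [bIJ sJn Jx bsx]]]] : exists b s x, [/\ colon I J b, colon J n s,
    (J : set S) x & ~ ideal_mul I J (b * (s * x))].
  apply: contrapT => H; apply: hcolon => b bIJ _ [t [s [x [sJn Jx ->]]]].
  rewrite mulr_sumr; apply: ideal_mul_sum => i; apply: contrapT => bsx.
  by apply: H; exists b, (s i), (x i).
have Isb : ~ (I : set S) (s * b).
  by move=> Isb; apply: bsx; rewrite mulrA [b * s]mulrC; exact: ideal_mul_in.
have nsb r : (n : set S) r -> (I : set S) (r * (s * b)).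
  by move=> /sJn Jsr; rewrite mulrA [r * s]mulrC [_ * b]mulrC; apply: bIJ.
have Js : ~ (J : set S) s by move=> /bIJ; rewrite mulrC.
have nJs r : (n : set S) r -> (J : set S) (r * s) by move=> /sJn; rewrite mulrC.
have socI := gorenstein_quot_colon_socle hS hI Isb nsb.
(* If [c] is not in [J], some [d] has [d c - s] in [J]. Multiplying by [b] puts [s b] in [I], a
   contradiction; so [I : b] lies in [J]. *)
have colon_b c : (I : set S) (c * b) -> (J : set S) c.
  move=> Icb; apply: contrapT => Jc.
  have [|d _ Jdc] := gorenstein_quot_colon_socle hS hJ Js nJs (x := 0) (y := c).
    by move=> [j [_ [Jj [r ->] cE]]]; apply: Jc; rewrite cE mulr0 addr0.
  apply: Isb; have := ideal_setD iI (bIJ _ Jdc) (ideal_setM (- d) iI Icb).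
  rewrite mulrBr mulNr addrAC mulrCA [b * c]mulrC subrr add0r.
  move=> /(ideal_setM (-1) iI).
  by rewrite mulN1r opprK mulrC.
have JE : J = ideal_add I (principal x) :> set S.
  apply/seteqP; split=> [y Jy|_ [i [_ [Ii [r ->] ->]]]]; last first.
    by apply: ideal_setD => //; [exact: hIJ|exact: ideal_setM].
  apply: contrapT => /socI[c Icx Icy]; apply: bsx.
  (* Each summand is an element of [I] times an element of [J]. *)
  have -> : b * (s * x) =
      \sum_(i < 2) (if i == 0 then c * x * y else (s * b - c * y) * x).
    rewrite big_ord_recl big_ord1 /= mulrBl [c * x * y]mulrAC addrC subrK.
    by rewrite mulrCA mulrA.
  apply: ideal_mul_sum => i; case: (i == 0); apply: ideal_mul_in => //.
  by have := ideal_setM (-1) iI Icy; rewrite mulN1r opprB.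
have colonE : colon I J = ideal_add I (principal b).
  apply/seteqP; split=> [y yIJ|_ [i [_ [Ii [r ->] ->]]] z Jz]; last first.
    rewrite mulrDl; apply: ideal_setD => //; first by rewrite mulrC; apply: ideal_setM.
    by rewrite -mulrA; apply: ideal_setM => //; apply: bIJ.
  (* As [c] lies in [J] and [y] in [I : J], [c y] is in [I], hence so is [s b]. *)
  apply: contrapT => /socI[c /colon_b Jc Icy]; apply: Isb.
  have := ideal_setD iI (yIJ _ Jc) (ideal_setM (-1) iI Icy).
  by rewrite mulN1r opprB [y * c]mulrC addrCA subrr addr0.
(* With [J = I + (x)], the annihilator of the image of [x] comes from [I : J], and that of the image
   of [b] from [I : b = J]. *)
exists x, b; split=> //; split; apply/seteqP; split=> y.
- rewrite /ann /= -[y]reprK -rmorphM => /ideal_quot_pi0 Iyx.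
  apply/principal_pi; rewrite -colonE => z; rewrite JE => -[i [_ [Ii [r ->] ->]]].
  by rewrite mulrDr mulrCA; apply: ideal_setD => //; apply: ideal_setM.
- move=> [r ->]; rewrite /ann /= -mulrA -rmorphM /=.
  by have /ideal_quot_pi0 -> := bIJ _ Jx; rewrite mulr0.
- rewrite /ann /= -[y]reprK -rmorphM => /ideal_quot_pi0/colon_b Jy.
  by apply/principal_pi; rewrite -JE.
move=> [r ->]; rewrite /ann /= -mulrA -rmorphM /= [x * b]mulrC.
by have /ideal_quot_pi0 -> := bIJ _ Jx; rewrite mulr0.
Qed.
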